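(* Let $\psi : M^{2}\rightarrow \mathbb{L}^4$ be a spacelike surface which factors through the future lightcone $\Lambda^{+}$, i.e. $\psi(M^2)\subset\Lambda^+$. Put $\xi=\psi$ and $T=\partial_0\circ\psi+\psi_*(\nabla\psi_0)$. Then the mean curvature vector field $\mathbf{H}$ and the Gauss curvature $K$ of $M^2$ are given by $$ \mathbf{H}=\left(\frac{\triangle\psi_{0}}{2\,\psi_{0}}-\frac{1+\| \nabla\psi_{0}\|^2}{\psi_{0}^{2}}\right)\xi+\frac{1}{\psi_{0}}\,T, $$ $$ K=\frac{1+\| \nabla\psi_{0}\|^2}{\psi_{0}^2}-\frac{\triangle\psi_{0}}{\psi_{0}}, $$ and therefore $$ K=\langle \mathbf{H},\mathbf{H}\rangle. $$
   Context: $\mathbb{L}^4$ is Lorentz-Minkowski spacetime: $\mathbb{R}^4$ with the metric $\langle\,,\,\rangle=-(dx_0)^2+(dx_1)^2+(dx_2)^2+(dx_3)^2$. A spacelike surface is a smooth immersion $\psi:M^2\to\mathbb{L}^4$ of a connected $2$-dimensional smooth manifold such that the induced metric (also denoted $\langle\,,\,\rangle$) is Riemannian. $\Lambda^+=\{v\in\mathbb{L}^4:\langle v,v\rangle=0,\ v_0>0\}$. $\partial_0=\partial/\partial x_0$, $\partial_0\circ\psi$ is its restriction along $\psi$, and $\psi_0$ is the $x_0$-component of $\psi$. $\nabla\psi_0$, $\triangle\psi_0$ (= divergence of the gradient), $\|\cdot\|$ are the gradient, Laplacian and norm for the induced metric; $K$ is the Gauss curvature of the induced metric. The second fundamental form $\mathrm{II}$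 is the normal part of $\overline{\nabla}_XY$ ($\overline\nabla$ the flat connection of $\mathbb{L}^4$), and $\mathbf{H}=\frac12\mathrm{tr}_{\langle\,,\,\rangle}\mathrm{II}$. *)

(* Defs.v *)
From HB Require Import structures.
From mathcomp Require Import all_boot all_order all_algebra.
From mathcomp Require Import all_classical all_reals all_analysis.

Set Implicit Arguments.
Unset Strict Implicit.
Unset Printing Implicit Defensive.

Import Order.TTheory GRing.Theory Num.Theory.
Import numFieldNormedType.Exports.
Local Open Scope classical_set_scope.
Local Open Scope ring_scope.

Section Smoothness.
Context {R : realType}.

(* Coordinate basis vector of R^n, as a row vector. *)
Definition ebase {n : nat} (i : 'I_n) : 'rV[R]_n := delta_mx 0 i.

Definition iter_partial {W : normedModType R} (s : seq 'I_2)
    (f : 'rV[R]_2 -> W) : 'rV[R]_2 -> W :=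
  foldr (fun i h => fun x => 'D_(ebase i) h x) f s.

(* C^infinity on an open set U: every iterated partial derivative is
   Frechet differentiable (hence continuous) at every point of U. *)
Definition smooth_on {W : normedModType R} (U : set 'rV[R]_2)
    (f : 'rV[R]_2 -> W) : Prop :=
  forall (s : seq 'I_2) (x : 'rV[R]_2), U x ->
    differentiable (iter_partial s f) x.

End Smoothness.

Section Manifold.
Context {R : realType}.

(* A homeomorphism between open subsets of M and of R^2.  Both maps are total
   functions; their values outside of chart_dom and chart_img are irrelevant. *)
Record chart (M : topologicalType) := Chart {
  chart_dom : set M;
  coord : M -> 'rV[R]_2;
  param : 'rV[R]_2 -> M;
  chart_dom_open : open chart_dom;
  chart_img_open : open (coord @` chart_dom);
  coordK : forall p, chart_dom p -> param (coord p) = p;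
  coord_continuous : {within chart_dom, continuous coord};
  param_continuous : {within coord @` chart_dom, continuous param}
}.

Definition chart_img (M : topologicalType) (c : chart M) : set 'rV[R]_2 :=
  coord c @` chart_dom c.

End Manifold.

Arguments chart R M : clear implicits.

(* 2-dimensional smooth manifold; the atlas need not be maximal (but may be). *)
Record smooth_surface (R : realType) := SmoothSurface {
  surface_space :> topologicalType;
  atlas : set (chart R surface_space);
  surface_hausdorff : hausdorff_space surface_space;
  surface_second_countable : @second_countable surface_space;
  atlas_cover : forall p : surface_space, exists2 c, atlas c & chart_dom c p;
  atlas_smooth : forall c d, atlas c -> atlas d ->
    smooth_on (coord c @` (chart_dom c `&` chart_dom d)) (coord d \o param c)
}.

(* Riemannian geometry on an open subset of R^2: g x is the Gram matrix of the
   metric at x in the coordinate basis, and tangent vectors are the rows of their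
   components. *)
Section Riemannian.
Context {R : realType}.
Implicit Types (g : 'rV[R]_2 -> 'M[R]_2) (x v w : 'rV[R]_2)
  (X Y : 'rV[R]_2 -> 'rV[R]_2) (f : 'rV[R]_2 -> R).

Definition metric_dot g x v w : R := (v *m g x *m w^T) 0 0.

Definition metric_norm g x v : R := Num.sqrt (metric_dot g x v v).

Definition riemannian_at g x : Prop :=
  (g x)^T = g x /\ forall v, v != 0 -> 0 < metric_dot g x v v.

(* Gamma^k_{ij} of the Levi-Civita connection. *)
Definition christoffel g x (k i j : 'I_2) : R :=
  2^-1 * \sum_(l < 2) (invmx (g x)) k l *
    ('D_(ebase i) (fun y => g y j l) x + 'D_(ebase j) (fun y => g y i l) x
     - 'D_(ebase l) (fun y => g y i j) x).

(* Covariant derivative of X along the i-th coordinate field. *)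
Definition nabla g (i : 'I_2) X x : 'rV[R]_2 :=
  \row_k ('D_(ebase i) (fun y => X y 0 k) x
          + \sum_(j < 2) christoffel g x k i j * X x 0 j).

Definition gradient g f x : 'rV[R]_2 :=
  \row_k \sum_(j < 2) (invmx (g x)) k j * 'D_(ebase j) f x.

(* Trace of v |-> nabla_v X. *)
Definition divergence g X x : R := \sum_(i < 2) nabla g i X x 0 i.

Definition laplacian g f x : R := divergence g (gradient g f) x.

(* R(d_i, d_j) X; the bracket term vanishes for coordinate fields. *)
Definition riemann g (i j : 'I_2) X x : 'rV[R]_2 :=
  nabla g i (nabla g j X) x - nabla g j (nabla g i X) x.

(* <R(d_0, d_1) d_1, d_0> / (g_00 g_11 - g_01^2). *)
Definition gauss_curvature g x : R :=
  metric_dot g x (riemann g 0 1 (fun=> ebase 1) x) (ebase 0) / \det (g x).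

End Riemannian.

Section Lorentz.
Context {R : realType}.
Implicit Types (u v : 'rV[R]_4) (F : 'rV[R]_2 -> 'rV[R]_4) (x : 'rV[R]_2)
  (X Y : 'rV[R]_2 -> 'rV[R]_2).

Definition lorentz u v : R :=
  - (u 0 0 * v 0 0) + \sum_(i < 3) u 0 (lift ord0 i) * v 0 (lift ord0 i).

Definition future_lightcone : set 'rV[R]_4 :=
  [set v | lorentz v v = 0 /\ 0 < v 0 0].

(* F is a local parametrization of a surface; its induced metric is the
   pull-back of the Lorentz product. *)
Definition induced_metric F x : 'M[R]_2 :=
  \matrix_(i, j) lorentz ('d F x (ebase i)) ('d F x (ebase j)).

(* Orthogonal projection onto the tangent plane: the k-th component is
   sum_l g^{kl} <v, d_l F>. *)
Definition tangent_part F x v : 'rV[R]_4 :=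
  'd F x (\row_k \sum_(l < 2) (invmx (induced_metric F x)) k l
                              * lorentz v ('d F x (ebase l))).

Definition normal_part F x v : 'rV[R]_4 := v - tangent_part F x v.

(* The flat connection differentiates the components of dF(Y) along X. *)
Definition second_form F X Y x : 'rV[R]_4 :=
  normal_part F x ('D_(X x) (fun y => 'd F y (Y y)) x).

Definition mean_curvature F x : 'rV[R]_4 :=
  2^-1 *: \sum_(i < 2) \sum_(j < 2) (invmx (induced_metric F x)) i j *:
    second_form F (fun=> ebase i) (fun=> ebase j) x.

End Lorentz.

(* Geometric quantities of psi : M -> L^4 at a point p, computed in a chart c
   around p.  Tangent vectors are given by their components in c. *)
Section SurfaceInL4.
Context {R : realType} {M : smooth_surface R}.
Implicit Types (psi : M -> 'rV[R]_4) (c : chart R M) (f : M -> R) (p : M).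

Definition smooth_map psi : Prop :=
  forall c, atlas c -> smooth_on (chart_img c) (psi \o param c).

Definition tangent_map psi c p (v : 'rV[R]_2) : 'rV[R]_4 :=
  'd (psi \o param c) (coord c p) v.

Definition immersion psi : Prop :=
  smooth_map psi /\
  forall c p, atlas c -> chart_dom c p -> injective (tangent_map psi c p).

Definition first_form psi c : 'rV[R]_2 -> 'M[R]_2 :=
  induced_metric (psi \o param c).

Definition spacelike psi : Prop :=
  immersion psi /\
  forall c p, atlas c -> chart_dom c p ->
    riemannian_at (first_form psi c) (coord c p).

Definition surf_grad psi c f p : 'rV[R]_2 :=
  gradient (first_form psi c) (f \o param c) (coord c p).

Definition surf_norm psi c p (v : 'rV[R]_2) : R :=
  metric_norm (first_form psi c) (coord c p) v.

Definition surf_laplacian psi c f p : R :=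
  laplacian (first_form psi c) (f \o param c) (coord c p).

Definition surf_gauss psi c p : R :=
  gauss_curvature (first_form psi c) (coord c p).

Definition surf_mean psi c p : 'rV[R]_4 :=
  mean_curvature (psi \o param c) (coord c p).

Definition height psi p : R := psi p 0 0.

Definition T_field psi c p : 'rV[R]_4 :=
  ebase 0 + tangent_map psi c p (surf_grad psi c (height psi) p).

End SurfaceInL4.

(* Main.v *)
(* In a chart, write F for the parametrization.  The position vector xi = F is
   null and normal, and T is the normal part of the time axis, with <xi, T> =
   - psi0 and <T, T> = - (1 + |grad psi0|^2); together they span the normal plane.
   Differentiating <F, F> = 0 twice gives <II, xi> = - g, and <II, T> is minus the
   Hessian of psi0, so II is determined by g and that Hessian: its trace is the
   formula for H, and the Gauss equation turns it into the formula for K. *)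
Require Import Defs.
From HB Require Import structures.
From mathcomp Require Import all_boot all_order all_algebra.
From mathcomp Require Import all_classical all_reals all_analysis.
From mathcomp Require Import ring lra.
Import Order.TTheory GRing.Theory Num.Theory.
Import numFieldNormedType.Exports.
Local Open Scope classical_set_scope.
Local Open Scope ring_scope.

(** * Symmetry of second derivatives *)

Section MixedPartials.
Context {R : realType} {V : normedModType R}.
Implicit Types (f : V -> R) (x y v w : V).

(** The two difference quotients coincide as functions of the increment; this prepares the
    one-variable mean value theorem. *)
Lemma is_derive_line f (s : R) y v l : is_derive (s *: v + y) v f l ->
  is_derive s (1 : R) (fun t : R => f (t *: v + y)) l.
Proof.
have E : (fun h : R => h^-1 *: ((f \o shift (s *: v + y)) (h *: v) - f (s *: v + y)))
   = (fun h : R => h^-1 *: (((fun t : R => f (t *: v + y)) \o shift s) (h *: 1)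
                 - f (s *: v + y))).
  by apply/funext => h /=; rewrite [h *: 1]mulr1 scalerDl addrA.
move=> [df <-]; split; first by rewrite /derivable -E.
by rewrite /derive -E.
Qed.

(** The mean value theorem along [v] turns the second difference into [t] times an increment of
    [fv], and the first-order expansion of [fv] at [x] evaluates that increment as [t * 'D_w fv x]
    up to o(t). *)
Lemma second_difference f fv x v w :
  (\forall y \near x, is_derive y v f (fv y)) -> differentiable fv x ->
  forall e : R, 0 < e -> \forall t \near (0 : R)^'+,
    `|f (x + t *: v + t *: w) - f (x + t *: v) - f (x + t *: w) + f x
      - t ^+ 2 * 'D_w fv x| <= e * t ^+ 2.
Proof.
move=> df ddf e e0.
(* [t * n] bounds the norm of [s *: v + r *: w] for [s], [r] in [0, t]; the summand 1 keeps [n]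
   positive. Two expansion errors [e / (2 * n) * (t * n)] will add up to [e * t]. *)
set n := `|v| + `|w| + 1.
have n0 : 0 < n by rewrite /n ltr_wpDl// addr_ge0.
have e'0 : 0 < e / (2 * n) by rewrite divr_gt0// mulr_gt0.
have /eqaddoP/(_ _ e'0) := diff_locally ddf.
move=> /nbhs_ballP[d1 /= d10 H1].
move: df => /nbhs_ballP[d2 /= d20 H2].
near=> t.
have t0 : 0 < t by near: t; exact: nbhs_right_gt.
have tn1 : t * n < d1.
  by rewrite -ltr_pdivlMr//; near: t; apply: nbhs_right_lt; rewrite divr_gt0.
have tn2 : t * n < d2.
  by rewrite -ltr_pdivlMr//; near: t; apply: nbhs_right_lt; rewrite divr_gt0.
have bnd (s r : R) : 0 <= s <= t -> 0 <= r <= t -> `|s *: v + r *: w| <= t * n.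
  move=> /andP[s0 st] /andP[r0 rt]; rewrite (le_trans (ler_normD _ _))//.
  rewrite !normrZ !ger0_norm// /n !mulrDr mulr1 -addrA lerD ?ler_wpM2r//.
  by rewrite ler_wpDr ?ler_wpM2r// ltW.
have dfat (s r : R) : 0 <= s <= t -> 0 <= r <= t ->
    is_derive (s *: v + (r *: w + x)) v f (fv (s *: v + (r *: w + x))).
  move=> hs hr; apply: H2; rewrite -ball_normE/= addrA opprD addrCA subrr addr0.
  by rewrite normrN (le_lt_trans (bnd _ _ hs hr)).
have D1 (s r : R) : 0 <= s <= t -> 0 <= r <= t ->
  `|fv (s *: v + (r *: w + x)) - fv x
     - 'd fv x (s *: v + r *: w)| <= e / (2 * n) * (t * n).
  move=> hs hr.
  have : ball 0 d1 (s *: v + r *: w).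
    by rewrite -ball_normE/= sub0r normrN (le_lt_trans (bnd _ _ hs hr)).
  move=> /H1; rewrite -[X in `|X|]/(fv (s *: v + r *: w + x)
    - (fv x + 'd fv x (s *: v + r *: w))).
  rewrite -(addrA (s *: v)) opprD (addrA (fv _)) => /le_trans; apply.
  by apply: ler_wpM2l; [exact: ltW|exact: bnd].
(* The increment of [phi] over [0, t] is the second difference. *)
pose phi s := f (s *: v + (t *: w + x)) - f (s *: v + x).
have tt : 0 <= t <= t by rewrite lexx ltW.
have zt : (0 : R) <= 0 <= t by rewrite lexx ltW.
have dphi (s : R) : 0 <= s <= t -> is_derive s (1 : R) phi
    (fv (s *: v + (t *: w + x)) - fv (s *: v + x)).
  move=> hs; apply: is_deriveB; apply: is_derive_line.
    exact: dfat.
  by have := dfat s 0 hs zt; rewrite scale0r add0r.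
have dphi' (s : R) : s \in `]0, t[%R -> is_derive s (1 : R) phi
    (fv (s *: v + (t *: w + x)) - fv (s *: v + x)).
  by rewrite in_itv/= => /andP[s0 st]; apply: dphi; rewrite !ltW.
have cphi : {within `[0, t], continuous phi}.
  apply: continuous_in_subspaceT => s; rewrite inE/= in_itv/= => hs.
  apply: differentiable_continuous; apply/derivable1_diffP.
  exact: (@ex_derive _ _ _ _ _ _ _ (dphi s hs)).
have [c] := MVT t0 dphi' cphi.
rewrite in_itv/= => /andP[c0 ct]; rewrite subr0 /phi !scale0r !add0r => E.
have hc : 0 <= c <= t by rewrite !ltW.
have Dt := D1 c t hc tt.
have Dz := D1 c 0 hc zt.
rewrite scale0r add0r addr0 in Dz.
set A := fv (c *: v + (t *: w + x)) in E Dt.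
set B := fv (c *: v + x) in E Dz.
have -> : f (x + t *: v + t *: w) - f (x + t *: v) - f (x + t *: w) + f x
   = (A - B) * t.
  have -> : x + t *: v + t *: w = t *: v + (t *: w + x).
    by rewrite (addrC x) -addrA (addrC x).
  by rewrite -E (addrC x) (addrC x); ring.
rewrite deriveE//.
set L := 'd fv x w.
have Dw : 'd fv x (c *: v + t *: w) = 'd fv x (c *: v) + t * L.
  by rewrite linearD [X in _ + X]linearZ.
rewrite Dw in Dt.
have -> : (A - B) * t - t ^+ 2 * L = t * (A - B - t * L) by ring.
rewrite normrM gtr0_norm// [X in _ <= X](_ : _ = t * (e * t)); last by ring.
apply: ler_wpM2l; first exact: ltW.
have eE : e * t = e / (2 * n) * (t * n) + e / (2 * n) * (t * n).
  by field; rewrite gt_eqF.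
rewrite eE.
have -> : A - B - t * L = (A - fv x - ('d fv x (c *: v) + t * L))
   - (B - fv x - 'd fv x (c *: v)) by ring.
by rewrite (le_trans (ler_normB _ _))// lerD.
Unshelve. all: by end_near. Qed.

(** The second difference is symmetric in [v] and [w], so [t ^+ 2] times either mixed derivative
    approximates the same number up to [e / 2 * t ^+ 2], with [e] arbitrary. *)
Lemma deriveC f fv fw x v w :
  (\forall y \near x, is_derive y v f (fv y)) ->
  (\forall y \near x, is_derive y w f (fw y)) ->
  differentiable fv x -> differentiable fw x -> 'D_w fv x = 'D_v fw x.
Proof.
move=> dfv dfw dv dw; apply/eqP; rewrite -subr_eq0 -normr_le0.
apply/ler_addgt0Pr => e e0; rewrite add0r.
have e20 : 0 < e / 2 by rewrite divr_gt0.
have Hv := second_difference f fv x v w dfv dv (e / 2) e20.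
have Hw := second_difference f fw x w v dfw dw (e / 2) e20.
have [t [t0 hv hw]] : exists t : R, [/\ 0 < t,
    `|f (x + t *: v + t *: w) - f (x + t *: v) - f (x + t *: w) + f x
      - t ^+ 2 * 'D_w fv x| <= e / 2 * t ^+ 2 &
    `|f (x + t *: w + t *: v) - f (x + t *: w) - f (x + t *: v) + f x
      - t ^+ 2 * 'D_v fw x| <= e / 2 * t ^+ 2].
  have [t [[hv hw] t0]] := @filter_ex _ _ _ _ (filterI (filterI Hv Hw) (nbhs_right_gt 0)).
  by exists t; split; [exact: t0|exact: hv|exact: hw].
have t20 : 0 < t ^+ 2 by rewrite exprn_gt0.
rewrite -(ler_pM2l t20) -{1}(gtr0_norm t20) -normrM.
set a := 'D_w _ x in hv *; set b := 'D_v _ x in hw *.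
rewrite addrAC in hw.
set P := f (x + t *: v + t *: w) in hv.
rewrite -[x + t *: w + t *: v]addrA [t *: w + _]addrC addrA -/P in hw.
set Q := f (x + t *: v) in hv hw; set S := f (x + t *: w) in hv hw.
have -> : t ^+ 2 * (a - b) = (P - S - Q - t ^+ 2 * b + f x) -
  (P - Q - S + f x - t ^+ 2 * a) by ring.
rewrite (le_trans (ler_normB _ _))// [X in _ <= X](_ : _ = e / 2 * t ^+ 2 + e / 2 * t ^+ 2).
  exact: lerD.
by field.
Qed.

End MixedPartials.

(** * The Lorentz product *)

Lemma sum_ord2 (V : nmodType) (f : 'I_2 -> V) : \sum_(i < 2) f i = f 0 + f 1.
Proof.
by rewrite big_ord_recl big_ord1; congr (f _ + f _); apply/val_inj.
Qed.

Section LorentzProduct.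
Context {R : realType}.
Implicit Types u v w : 'rV[R]_4.

(** A polynomial in the entries, so that [ring] settles the bilinear identities. *)
Let lorentzE u v : lorentz u v = - (u 0 0 * v 0 0) +
  (u 0 (lift ord0 0) * v 0 (lift ord0 0) +
  (u 0 (lift ord0 1) * v 0 (lift ord0 1)
   + u 0 (lift ord0 2) * v 0 (lift ord0 2))).
Proof.
rewrite /lorentz !big_ord_recl big_ord0 addr0.
by congr (_ + (_ * _ + (_ * _ + _ * _))); congr (_ _ _); apply/val_inj.
Qed.

Lemma lorentzC u v : lorentz u v = lorentz v u.
Proof. by rewrite !lorentzE; ring. Qed.

Lemma lorentzDl u v w : lorentz (u + v) w = lorentz u w + lorentz v w.
Proof. by rewrite !lorentzE !mxE; ring. Qed.

Lemma lorentzZl a u w : lorentz (a *: u) w = a * lorentz u w.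
Proof. by rewrite !lorentzE !mxE; ring. Qed.

Lemma lorentzNl u w : lorentz (- u) w = - lorentz u w.
Proof. by rewrite -scaleN1r lorentzZl mulN1r. Qed.

Lemma lorentzDr u v w : lorentz w (u + v) = lorentz w u + lorentz w v.
Proof. by rewrite lorentzC lorentzDl !(lorentzC w). Qed.

Lemma lorentzZr a u w : lorentz w (a *: u) = a * lorentz w u.
Proof. by rewrite lorentzC lorentzZl (lorentzC w). Qed.

Lemma lorentz_ebase0 u : lorentz (ebase 0) u = - u 0 0.
Proof. by rewrite lorentzE !mxE /=; ring. Qed.

Lemma is_derive_coord {V : normedModType R} {m n} (f : V -> 'M[R]_(m, n)) (x v : V) i j :
  differentiable f x -> is_derive x v (fun y => f y i j) ('D_v f x i j).
Proof.
move=> fx; have df : derivable f x v by exact: diff_derivable.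
split; first by move/derivable_mxP : df; exact.
by rewrite derive_mx// mxE.
Qed.

Lemma is_derive_lorentz {V : normedModType R} (f g : V -> 'rV[R]_4) (x v : V) :
  differentiable f x -> differentiable g x ->
  is_derive x v (fun y => lorentz (f y) (g y))
    (lorentz ('D_v f x) (g x) + lorentz (f x) ('D_v g x)).
Proof.
move=> df dg.
have D (i : 'I_4) : is_derive x v (fun y => f y 0 i * g y 0 i)
    (f x 0 i * 'D_v g x 0 i + g x 0 i * 'D_v f x 0 i).
  by apply: is_deriveM; exact: is_derive_coord.
rewrite (_ : (fun y => _) = fun y => - (f y 0 0 * g y 0 0) +
  (f y 0 (lift ord0 0) * g y 0 (lift ord0 0) +
  (f y 0 (lift ord0 1) * g y 0 (lift ord0 1)
   + f y 0 (lift ord0 2) * g y 0 (lift ord0 2)))); last first.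
  by apply/funext => y; rewrite lorentzE.
apply: (@is_derive_eq _ _ _ _ _ _ _ _ (is_deriveD (is_deriveN (D _))
  (is_deriveD (D _) (is_deriveD (D _) (D _))))).
by rewrite !lorentzE; ring.
Qed.

(* The block Gram matrix is B eta B^T for B the matrix of the four vectors, so B
   is invertible. *)
Lemma lorentz_nondegenerate (a b : 'I_2 -> 'rV[R]_4) v :
  (forall i j, lorentz (a i) (b j) = 0) ->
  \det (\matrix_(i, j) lorentz (a i) (a j)) != 0 ->
  \det (\matrix_(i, j) lorentz (b i) (b j)) != 0 ->
  (forall i, lorentz v (a i) = 0) -> (forall i, lorentz v (b i) = 0) -> v = 0.
Proof.
move=> ab da db va vb.
pose eta : 'M[R]_4 := \matrix_(i, j) ((i == j)%:R * (if i == 0 then -1 else 1)).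
have etaE u w : lorentz u w = (u *m eta *m w^T) 0 0.
  rewrite mxE [RHS]big_ord_recl /lorentz; congr (_ + _).
    rewrite mxE (bigD1 ord0)//= big1 ?addr0 ?mxE ?eqxx//=; last first.
      by move=> i i0; rewrite !mxE (negbTE i0) mul0r mulr0.
    by rewrite mul1r mulrN1 mulNr.
  apply: eq_bigr => i _; rewrite mxE (bigD1 (lift ord0 i))//=.
  rewrite big1 ?addr0 ?mxE ?eqxx//=; last first.
    by move=> j ji; rewrite !mxE (negbTE ji) mul0r mulr0.
  by rewrite !mulr1.
pose B : 'M[R]_(2 + 2, 4) := col_mx (\matrix_i a i) (\matrix_i b i).
have gram : B *m eta *m B^T = block_mx (\matrix_(i, j) lorentz (a i) (a j)) 0
    0 (\matrix_(i, j) lorentz (b i) (b j)).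
  rewrite /B mul_col_mx tr_col_mx mul_col_row.
  have E (p q : 'I_2 -> 'rV[R]_4) : (\matrix_i p i) *m eta *m (\matrix_i q i)^T =
      \matrix_(i, j) lorentz (p i) (q j).
    apply/matrixP => i j; rewrite [RHS]mxE etaE -[in RHS](rowK p i) -[in RHS](rowK q j).
    by rewrite -row_mul !mxE; apply: eq_bigr => k _; rewrite !mxE.
  rewrite !E; congr block_mx; apply/matrixP => i j; rewrite !mxE//.
  by rewrite lorentzC.
have : B *m eta *m B^T \in unitmx.
  by rewrite gram unitmxE det_ublock unitfE mulf_neq0.
rewrite !unitmx_mul => /andP[/andP[_ ue] uB].
have : v *m eta *m B^T = 0.
  rewrite /B tr_col_mx mul_mx_row -[RHS]row_mx0.
  have E (p : 'I_2 -> 'rV[R]_4) : (forall i, lorentz v (p i) = 0) ->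
    v *m eta *m (\matrix_i p i)^T = 0.
    move=> vp; apply/rowP => i; rewrite [RHS]mxE -(vp i) etaE -[in RHS](rowK p i).
    by rewrite !mxE; apply: eq_bigr => k _; rewrite !mxE.
  by rewrite !E.
move=> /(congr1 (mulmxr (invmx B^T))) /=; rewrite mulmxK// mul0mx.
by move=> /(congr1 (mulmxr (invmx eta))) /=; rewrite mulmxK// mul0mx.
Qed.

End LorentzProduct.

(** * Partial derivatives of smooth vector-valued maps *)

Section SmoothRows.
Context {R : realType}.
Implicit Types (U : set 'rV[R]_2).

(** In [iter_partial] the last index is differentiated first, so an initial derivative appends [i]
    to the sequence. *)
Lemma smooth_on_partial {W : normedModType R} U (f : 'rV[R]_2 -> W) i :
  smooth_on U f -> smooth_on U ('D_(ebase i) f).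
Proof.
by move=> fs s x Ux; have := fs (rcons s i) x Ux; rewrite /iter_partial foldr_rcons.
Qed.

Lemma smooth_on_differentiable {W : normedModType R} U (f : 'rV[R]_2 -> W) x :
  smooth_on U f -> U x -> differentiable f x.
Proof. by move=> /(_ [::]) /= fs /fs. Qed.

Lemma differentiable_entry {V : normedModType R} {m n} (f : V -> 'M[R]_(m, n)) x i j :
  differentiable f x -> differentiable (fun y => f y i j) x.
Proof.
move=> df; apply: (@differentiable_comp _ _ _ _ f (fun N : 'M[R]_(m, n) => N i j)) => //.
exact: differentiable_coord.
Qed.

(** Derivatives of a row are taken entrywise, which reduces the claim to the scalar [deriveC];
    openness of [U] supplies the derivatives near [x]. *)
Lemma partialC {n} U (f : 'rV[R]_2 -> 'rV[R]_n) i j x : open U -> smooth_on U f ->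
  U x -> 'D_(ebase i) ('D_(ebase j) f) x = 'D_(ebase j) ('D_(ebase i) f) x.
Proof.
move=> Uo fs Ux; apply/rowP => k.
have nU : \forall y \near x, U y by exact: open_nbhs_nbhs.
have df y : U y -> differentiable f y by apply: smooth_on_differentiable.
have ddf l y : U y -> differentiable ('D_(ebase l) f) y.
  by apply: smooth_on_differentiable; exact: smooth_on_partial.
have ddk l : differentiable (fun y => 'D_(ebase l) f y 0 k) x.
  exact/differentiable_entry/ddf.
have E l m : 'D_(ebase l) ('D_(ebase m) f) x 0 k
    = 'D_(ebase l) (fun y => 'D_(ebase m) f y 0 k) x.
  by have /is_derive_coord H := ddf m x Ux; rewrite derive_val.
have dk l : \forall y \near x,
    is_derive y (ebase l) (fun y => f y 0 k) ('D_(ebase l) f y 0 k).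
  by apply: filterS nU => y /df/is_derive_coord; exact.
have H := deriveC _ _ _ x _ _ (dk j) (dk i) (ddk j) (ddk i).
exact: etrans (E i j) (etrans H (esym (E j i))).
Qed.

End SmoothRows.

(** * Metrics on the plane as 2 x 2 matrices *)

Section RiemannianPlane.
Context {R : realType}.
Implicit Types (g : 'rV[R]_2 -> 'M[R]_2) (x : 'rV[R]_2).

Lemma det_mx2 (A : 'M[R]_2) : \det A = A 0 0 * A 1 1 - A 0 1 * A 1 0.
Proof.
rewrite (expand_det_row _ 0) sum_ord2 /cofactor !det_mx11 !mxE/=.
have -> : lift 0 0 = 1 :> 'I_2 by apply/val_inj.
have -> : lift 1 0 = 0 :> 'I_2 by apply/val_inj.
by rewrite /bump/= expr0 expr1; ring.
Qed.

(** Minors are 1 x 1 here: [lift j 0] is the index other than [j]. *)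
Lemma invmx2E (A : 'M[R]_2) i j : A \in unitmx ->
  invmx A i j = (\det A)^-1 * ((-1) ^+ (j + i) * A (lift j 0) (lift i 0)).
Proof.
by move=> uA; rewrite /invmx uA !mxE /cofactor det_mx11 !mxE.
Qed.

Lemma metric_dotE g x v w :
  metric_dot g x v w = \sum_i \sum_j g x i j * (v 0 i * w 0 j).
Proof.
rewrite /metric_dot mxE !sum_ord2 !mxE !sum_ord2; ring.
Qed.

Lemma metric_dot_ebase g x u j :
  metric_dot g x u (ebase j) = \sum_k g x k j * u 0 k.
Proof.
rewrite /metric_dot /ebase trmx_delta -colE !mxE.
by apply: eq_bigr => k _; rewrite mulrC.
Qed.

Lemma riemannian_sym g x i j : riemannian_at g x -> g x i j = g x j i.
Proof. by move=> [gT _]; rewrite -{1}gT mxE. Qed.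

Lemma riemannian_det_gt0 g x : riemannian_at g x -> 0 < \det (g x).
Proof.
move=> gx; have g10 := riemannian_sym g x 1 0 gx; case: gx => _ pos.
have g00 : 0 < g x 0 0.
  have := pos (ebase 0); rewrite metric_dotE !sum_ord2 !mxE/= !(mulr0, mulr1, addr0).
  by apply; apply/eqP => /rowP/(_ 0); rewrite !mxE/= => /eqP; rewrite oner_eq0.
(* This vector is orthogonal to [ebase 0], and its square norm is [g x 0 0 * \det (g x)]. *)
pose v : 'rV[R]_2 := \row_k (if k == 0 then - g x 0 1 else g x 0 0).
have := pos v; rewrite metric_dotE !sum_ord2 !mxE/= det_mx2 g10 => H.
have v0 : v != 0.
  by apply/eqP => /rowP/(_ 1); rewrite !mxE/= => /eqP; rewrite gt_eqF.
by move: (H v0) => {}H; rewrite -(pmulr_rgt0 _ g00); lra.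
Qed.

Lemma riemannian_unit g x : riemannian_at g x -> g x \in unitmx.
Proof. by move=> /riemannian_det_gt0 d; rewrite unitmxE unitfE gt_eqF. Qed.

Lemma metric_norm_sqr g x v : riemannian_at g x ->
  metric_norm g x v ^+ 2 = metric_dot g x v v.
Proof.
move=> [_ pos]; rewrite sqr_sqrtr//; have [->|/pos/ltW//] := eqVneq v 0.
by rewrite /metric_dot !mul0mx mxE.
Qed.

(** Cofactor over determinant is derivable entry by entry; this formula for [invmx] holds only at
    invertible matrices, whence the hypothesis on a neighbourhood. *)
Lemma derivable_invmx2 g x v i j :
  (\forall y \near x, g y \in unitmx) ->
  (forall k l, derivable (fun y => g y k l) x v) ->
  derivable (fun y => invmx (g y) i j) x v.
Proof.
move=> ug dg; have ux : g x \in unitmx by exact: nbhs_singleton ug.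
pose dt y := g y 0 0 * g y 1 1 - g y 0 1 * g y 1 0.
pose cf y := (-1) ^+ (j + i) * g y (lift j 0) (lift i 0).
apply: (@near_eq_derivable _ _ _ (fun y => (dt y)^-1 * cf y)).
  by apply: filterS ug => y uy; rewrite invmx2E// det_mx2.
apply: derivableM.
  apply: derivableV; first by rewrite /dt -det_mx2 -unitfE -unitmxE.
  by apply: derivableB; apply: derivableM; exact: dg.
by apply: derivableM; [exact: derivable_cst|exact: dg].
Qed.

End RiemannianPlane.

(** * Gauss-Weingarten formulas for a local parametrization *)

(* Components of the tangential part of v in the basis of the partials of F, so
   that tangent_part F x v is convertible to 'd F x (tangent_coef F x v). *)
Definition tangent_coef {R : realType} (F : 'rV[R]_2 -> 'rV[R]_4) (x : 'rV[R]_2)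
    (v : 'rV[R]_4) : 'rV[R]_2 :=
  \row_k \sum_(l < 2) invmx (induced_metric F x) k l * lorentz v ('d F x (ebase l)).

Section LocalSurface.
Context {R : realType} {U : set 'rV[R]_2} {F : 'rV[R]_2 -> 'rV[R]_4}.
Context (Uo : open U) (Fs : smooth_on U F).
Context (gU : forall y, U y -> riemannian_at (induced_metric F) y).
Implicit Types (x y : 'rV[R]_2) (v w : 'rV[R]_4) (i j k l m : 'I_2).

Local Notation g := (induced_metric F).
Local Notation D1 i := ('D_(ebase i) F).
Local Notation D2 i j := ('D_(ebase i) ('D_(ebase j) F)).

Lemma near_U x : U x -> \forall y \near x, U y.
Proof. by move=> Ux; exact: open_nbhs_nbhs. Qed.

Lemma differentiable_F x : U x -> differentiable F x.
Proof. exact: smooth_on_differentiable Fs. Qed.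

Lemma differentiable_D1 i x : U x -> differentiable (D1 i) x.
Proof. exact: smooth_on_differentiable (smooth_on_partial _ _ _ Fs). Qed.

Lemma differentiable_D2 i j x : U x -> differentiable (D2 i j) x.
Proof.
exact: smooth_on_differentiable (smooth_on_partial _ _ _ (smooth_on_partial _ _ _ Fs)).
Qed.

Lemma D2C i j x : U x -> D2 i j x = D2 j i x.
Proof. exact: partialC Uo Fs. Qed.

Lemma diff_ebase i x : U x -> 'd F x (ebase i) = D1 i x.
Proof. by move=> Ux; apply/esym/deriveE; exact: differentiable_F. Qed.

Lemma diff_row (u : 'rV[R]_2) x : U x -> 'd F x u = \sum_k u 0 k *: D1 k x.
Proof.
move=> Ux; rewrite [in LHS](row_sum_delta u) linear_sum; apply: eq_bigr => k _.
by rewrite linearZ -(diff_ebase _ _ Ux).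
Qed.

Lemma metricE i j x : U x -> g x i j = lorentz (D1 i x) (D1 j x).
Proof. by move=> Ux; rewrite mxE (diff_ebase _ _ Ux) (diff_ebase _ _ Ux). Qed.

Lemma metric_unit x : U x -> g x \in unitmx.
Proof. by move=> /gU/riemannian_unit. Qed.

Lemma is_derive_metric m i j x : U x ->
  is_derive x (ebase m) (fun y => g y i j)
    (lorentz (D2 m i x) (D1 j x) + lorentz (D1 i x) (D2 m j x)).
Proof.
move=> Ux; apply: (@near_eq_is_derive _ _ _ (fun y => lorentz (D1 i y) (D1 j y))).
  by apply: filterS (near_U _ Ux) => y Uy; rewrite metricE.
by apply: is_derive_lorentz; exact: differentiable_D1.
Qed.

Lemma sum_metric_invmx x i k : U x ->
  \sum_j g x i j * invmx (g x) j k = (i == k)%:R.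
Proof. by move=> /metric_unit/mulmxV/matrixP/(_ i k); rewrite !mxE. Qed.

Lemma tangent_coefE x v k : U x -> tangent_coef F x v 0 k =
  \sum_l invmx (g x) k l * lorentz v (D1 l x).
Proof.
by move=> Ux; rewrite mxE; apply: eq_bigr => l _; rewrite (diff_ebase _ _ Ux).
Qed.

(** Lowering the index with [g] cancels [invmx]: the tangential part of [v] has the same products
    with the tangent basis as [v] itself. *)
Lemma metric_tangent_coef x v l : U x ->
  \sum_k g x l k * tangent_coef F x v 0 k = lorentz v (D1 l x).
Proof.
move=> Ux.
under eq_bigr do rewrite tangent_coefE// mulr_sumr.
rewrite exchange_big/=.
under eq_bigr do (under eq_bigr do rewrite mulrA; rewrite -mulr_suml sum_metric_invmx//).
by rewrite (bigD1 l)//= eqxx mul1r big1 ?addr0// => i il; rewrite eq_sym (negbTE il) mul0r.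
Qed.

Lemma lorentz_tangent_part x v w : U x ->
  lorentz (tangent_part F x v) w = \sum_k tangent_coef F x v 0 k * lorentz (D1 k x) w.
Proof.
move=> Ux; rewrite -[tangent_part F x v]/('d F x (tangent_coef F x v)) diff_row//.
rewrite 2!sum_ord2; apply: etrans (lorentzDl _ _ _) _.
by congr (_ + _); exact: lorentzZl.
Qed.

Lemma lorentz_normal_part x v w : U x -> lorentz (normal_part F x v) w =
  lorentz v w - \sum_k tangent_coef F x v 0 k * lorentz (D1 k x) w.
Proof. by move=> Ux; rewrite lorentzDl lorentzNl lorentz_tangent_part. Qed.

Lemma lorentz_normal_part_tangent x v l : U x -> lorentz (normal_part F x v) (D1 l x) = 0.
Proof.
move=> Ux; rewrite lorentz_normal_part// -metric_tangent_coef//.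
apply/eqP; rewrite subr_eq0; apply/eqP; apply: eq_bigr => k _.
by rewrite -metricE// mulrC (riemannian_sym _ _ _ _ (gU _ Ux)).
Qed.

Lemma lorentz_normal_part_normal x v w : U x -> (forall l, lorentz w (D1 l x) = 0) ->
  lorentz (normal_part F x v) w = lorentz v w.
Proof.
move=> Ux wn; rewrite lorentz_normal_part// big1 ?subr0// => k _.
by rewrite lorentzC wn mulr0.
Qed.

(** Differentiating g_ij = <F_i, F_j> gives six terms; by symmetry of the second derivatives four
    cancel in pairs and 2 <F_ij, F_l> remains. Thus the Levi-Civita connection is the tangential
    part of the flat one. *)
Lemma christoffelE x k i j : U x ->
  christoffel g x k i j = tangent_coef F x (D2 i j x) 0 k.
Proof.
move=> Ux; rewrite tangent_coefE// /christoffel mulr_sumr; apply: eq_bigr => l _.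
pose L a b c := lorentz (D2 a b x) (D1 c x).
have LC a b c : L a b c = L b a c.
  have E := congr1 (fun v => lorentz v (D1 c x)) (D2C a b x Ux); exact E.
have H m a b : 'D_(ebase m) (fun y => g y a b) x = L m a b + L m b a.
  rewrite (@derive_val _ _ _ _ _ _ _ (is_derive_metric m a b x Ux)).
  congr (_ + _); exact: lorentzC.
rewrite (H i j l) (H j i l) (H l i j) -[lorentz _ _]/(L i j l).
clearbody L; rewrite (LC j i l) (LC l i j) (LC l j i).
by field.
Qed.

(** Provides the derivability that the product rule demands when the lowered components of a
    tangential part are differentiated. *)
Lemma derivable_tangent_coef (V : 'rV[R]_2 -> 'rV[R]_4) k m x : U x ->
  differentiable V x -> derivable (fun y => tangent_coef F y (V y) 0 k) x (ebase m).
Proof.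
move=> Ux dV; apply: (@near_eq_derivable _ _ _ (fun y =>
  \sum_l invmx (g y) k l * lorentz (V y) (D1 l y))).
  by apply: filterS (near_U _ Ux) => y Uy; rewrite tangent_coefE.
rewrite (_ : (fun y => _) = fun y => invmx (g y) k 0 * lorentz (V y) (D1 0 y) +
  invmx (g y) k 1 * lorentz (V y) (D1 1 y)); last by apply/funext => y; rewrite sum_ord2.
have L l : derivable (fun y => lorentz (V y) (D1 l y)) x (ebase m).
  have H := is_derive_lorentz V (D1 l) x (ebase m) dV (differentiable_D1 l x Ux).
  exact: (@ex_derive _ _ _ _ _ _ _ H).
have I l : derivable (fun y => invmx (g y) k l) x (ebase m).
  apply: derivable_invmx2; first by apply: filterS (near_U _ Ux) => y /metric_unit.
  move=> a b; exact: (@ex_derive _ _ _ _ _ _ _ (is_derive_metric m a b x Ux)).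
by apply: derivableD; apply: derivableM; [exact: I|exact: L|exact: I|exact: L].
Qed.

(* Gauss-Weingarten formula, with the free index lowered by the metric so that
   invmx (g x) is never differentiated explicitly. *)
Lemma metric_nabla_tangent_coef (V : 'rV[R]_2 -> 'rV[R]_4) (X : 'rV[R]_2 -> 'rV[R]_2)
    m l x : U x -> differentiable V x ->
  (\forall y \near x, X y = tangent_coef F y (V y)) ->
  \sum_k g x l k * nabla g m X x 0 k =
  lorentz ('D_(ebase m) V x) (D1 l x) + lorentz (normal_part F x (V x)) (D2 m l x).
Proof.
move=> Ux dV XV.
have Xx : X x = tangent_coef F x (V x) by exact: nbhs_singleton XV.
have dX k : is_derive x (ebase m) (fun y => X y 0 k) ('D_(ebase m) (fun y => X y 0 k) x).
  apply: derivableP; apply: near_eq_derivable (derivable_tangent_coef V k m x Ux dV).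
  by apply: filterS XV => y ->.
pose A k := lorentz (D2 m l x) (D1 k x).
pose B k := lorentz (D1 l x) (D2 m k x).
pose C j k := tangent_coef F x (D2 m j x) 0 k.
pose X' k := 'D_(ebase m) (fun y => X y 0 k) x.
have nablaE k : nabla g m X x 0 k = X' k + \sum_j C j k * X x 0 j.
  by rewrite mxE; congr (_ + _); apply: eq_bigr => j _; rewrite christoffelE.
have low j : B j = \sum_k g x l k * C j k.
  rewrite (metric_tangent_coef _ _ _ Ux); exact: lorentzC.
have normal : lorentz (normal_part F x (V x)) (D2 m l x) =
    lorentz (V x) (D2 m l x) - \sum_k X x 0 k * A k.
  rewrite (lorentz_normal_part _ _ _ Ux) -Xx.
  congr (_ - _); apply: eq_bigr => k _; congr (_ * _); exact: lorentzC.
(* Both sides differentiate the same function near [x]: the product of [V] with F_l, and its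
   expression as the lowered components of [X]. *)
have dlower : lorentz ('D_(ebase m) V x) (D1 l x) + lorentz (V x) (D2 m l x) =
    g x l 0 * X' 0 + X x 0 0 * (A 0 + B 0)
    + (g x l 1 * X' 1 + X x 0 1 * (A 1 + B 1)).
  have H := is_derive_lorentz V (D1 l) x (ebase m) dV (differentiable_D1 l x Ux).
  have H1 := is_deriveD (is_deriveM (is_derive_metric m l 0 x Ux) (dX 0))
      (is_deriveM (is_derive_metric m l 1 x Ux) (dX 1)).
  have e := @derive_val _ _ _ _ _ _ _ H; have e1 := @derive_val _ _ _ _ _ _ _ H1.
  refine (etrans (esym e) (etrans _ e1)); apply: near_eq_derive.
  apply: filterS2 (near_U _ Ux) XV => y Uy Xy.
  by rewrite -metric_tangent_coef// sum_ord2 -Xy.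
rewrite normal addrA dlower.
under eq_bigr do rewrite nablaE.
move: (g x) (X x) => G Y in low *.
clearbody A B C X'; rewrite (low 0) (low 1) !sum_ord2; ring.
Qed.

Lemma nabla_ebase i j x : U x ->
  nabla g i (fun=> ebase j) x = tangent_coef F x (D2 i j x).
Proof.
move=> Ux; apply/rowP => k; rewrite mxE derive_cst add0r (bigD1 j)//=.
rewrite big1; last by move=> l lj; rewrite !mxE (negbTE lj) andbF mulr0.
by rewrite addr0 !mxE !eqxx mulr1; move: (christoffelE x k i j Ux); rewrite mxE.
Qed.

(* The third derivatives of F cancel, so only normal parts survive. *)
Lemma gauss_curvatureE x : U x -> gauss_curvature g x =
  (lorentz (normal_part F x (D2 1 1 x)) (D2 0 0 x)
   - lorentz (normal_part F x (D2 0 1 x)) (D2 1 0 x)) / \det (g x).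
Proof.
move=> Ux; rewrite /gauss_curvature; congr (_ / _).
have near_nabla i j : \forall y \near x,
    nabla g i (fun=> ebase j) y = tangent_coef F y (D2 i j y).
  by apply: filterS (near_U _ Ux) => y /nabla_ebase.
have H1 := metric_nabla_tangent_coef _ _ 0 0 x Ux (differentiable_D2 1 1 x Ux)
   (near_nabla 1 1).
have H2 := metric_nabla_tangent_coef _ _ 1 0 x Ux (differentiable_D2 0 1 x Ux)
   (near_nabla 0 1).
have H3 : 'D_(ebase 0) (D2 1 1) x = 'D_(ebase 1) (D2 0 1) x.
  exact: (partialC U (D1 1) 0 1 x Uo (smooth_on_partial _ _ _ Fs) Ux).
(* Pairing with [ebase 0] lowers the index to 0, the form in which [H1] and [H2] are stated. *)
have lower (X Y : 'rV[R]_2) : metric_dot g x (X - Y) (ebase 0) =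
    \sum_k g x 0 k * X 0 k - \sum_k g x 0 k * Y 0 k.
  rewrite -sumrB metric_dot_ebase; apply: eq_bigr => k _.
  by rewrite (riemannian_sym _ _ k 0 (gU x Ux)) -mulrBr !mxE.
have cancel (a b c d : R) : a = b -> a + c - (b + d) = c - d by move=> ->; ring.
have H4 := congr1 (fun v => lorentz v (D1 0 x)) H3.
refine (etrans (lower _ _) (etrans (congr2 (fun a b => a - b) H1 H2) _)).
exact: cancel H4.
Qed.

(** * Gradient and Laplacian of the height function *)

Local Notation height := (fun y => F y 0 0).
Local Notation T x := (normal_part F x (ebase 0)).

Lemma tangent_coefN x v : U x -> tangent_coef F x (- v) = - tangent_coef F x v.
Proof.
move=> Ux; apply/rowP => k; rewrite !mxE -sumrN; apply: eq_bigr => l _.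
by rewrite lorentzNl mulrN.
Qed.

(** The time axis has square -1, so the j-th partial of psi0 is - <e_0, F_j>; this is the source of
    the sign. *)
Lemma gradient_height x : U x -> gradient g height x = tangent_coef F x (- ebase 0).
Proof.
move=> Ux; apply/rowP => k; rewrite tangent_coefE// mxE; apply: eq_bigr => j _.
have H := is_derive_coord F x (ebase j) 0 0 (differentiable_F x Ux).
rewrite (@derive_val _ _ _ _ _ _ _ H).
by rewrite lorentzNl lorentz_ebase0 opprK.
Qed.

(** Identifies the field T of the theorem with the normal part of the time axis. *)
Lemma gradient_height_normal x : U x ->
  ebase 0 + 'd F x (gradient g height x) = T x.
Proof.
by move=> Ux; rewrite gradient_height// tangent_coefN// linearN.
Qed.

(** Pythagoras for the time axis: -1 is the sum of the squares of its tangential part, minus the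
    gradient, and of its normal part T. *)
Lemma lorentz_gradient_normal x : U x -> lorentz (T x) (T x) =
  - (1 + metric_dot g x (gradient g height x) (gradient g height x)).
Proof.
move=> Ux; rewrite lorentz_normal_part_normal//; last first.
  by move=> l; exact: lorentz_normal_part_tangent.
rewrite lorentzC lorentz_normal_part// gradient_height//.
set u := tangent_coef F x (- ebase 0).
have -> : metric_dot g x u u = \sum_k u 0 k * lorentz (- ebase 0) (D1 k x).
  rewrite metric_dotE; apply: eq_bigr => k _.
  rewrite -metric_tangent_coef// -/u mulr_sumr; apply: eq_bigr => l _; ring.
rewrite opprD; congr (_ - _); first by rewrite lorentz_ebase0 mxE.
apply: eq_bigr => k _.
rewrite /u tangent_coefN// [(- _ : 'rV_2) 0 k]mxE lorentzNl mulrNN.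
by congr (_ * _); exact: lorentzC.
Qed.

(** The gradient is the tangential part of the constant field - e_0. Its flat derivative vanishes
    and its normal part is - T, so by the Gauss-Weingarten formula the Hessian is - <T, F_ij>. *)
Lemma laplacian_height x : U x -> laplacian g height x =
  - \sum_i \sum_j invmx (g x) i j * lorentz (T x) (D2 i j x).
Proof.
move=> Ux; rewrite /laplacian /divergence -sumrN; apply: eq_bigr => i _.
have XV : \forall y \near x, gradient g height y = tangent_coef F y (- ebase 0).
  by apply: filterS (near_U _ Ux) => y /gradient_height.
have lower l : \sum_k g x l k * nabla g i (gradient g height) x 0 k =
    - lorentz (T x) (D2 i l x).
  refine (etrans (metric_nabla_tangent_coef (fun=> - ebase 0) _ i l x Ux _ XV) _).
    exact: differentiable_cst.
  rewrite derive_cst -(scale0r (0 : 'rV[R]_4)) lorentzZl mul0r add0r.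
  rewrite -lorentzNl; congr lorentz.
  rewrite /normal_part -[tangent_part F x _]/('d F x (tangent_coef F x (- ebase 0))).
  by rewrite tangent_coefN// linearN opprK opprB addrC.
move: (nabla _ _ _ _) lower => Y lower.
(* Raises the index again, to recover the i-th component from the lowered ones. *)
transitivity (\sum_j invmx (g x) i j * \sum_k g x j k * Y 0 k).
  have /matrixP E := mulVmx (metric_unit x Ux).
  under eq_bigr do rewrite mulr_sumr.
  rewrite exchange_big/= (bigD1 i)//= [X in _ + X]big1 ?addr0 => [|k ki].
    under eq_bigr do rewrite mulrA.
    by rewrite -mulr_suml; have := E i i; rewrite !mxE eqxx => ->; rewrite mul1r.
  under eq_bigr do rewrite mulrA.
  by rewrite -mulr_suml; have := E i k; rewrite !mxE eq_sym (negbTE ki) => ->; rewrite mul0r.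
rewrite -sumrN; apply: eq_bigr => j _; rewrite lower.
exact: mulrN.
Qed.

(** * Surfaces in the future lightcone *)

Context (coneU : forall y, U y -> future_lightcone (F y)).

(** Differentiating <F, F> = 0 gives 2 <F, F_l> = 0. *)
Lemma lorentz_position_tangent x l : U x -> lorentz (F x) (D1 l x) = 0.
Proof.
move=> Ux; have dF := differentiable_F x Ux.
have H := is_derive_lorentz F F x (ebase l) dF dF.
have H0 : 'D_(ebase l) (fun y => lorentz (F y) (F y)) x = 0.
  rewrite -(derive_cst (0 : R) x (ebase l)); apply: near_eq_derive.
  by apply: filterS (near_U _ Ux) => y /coneU[].
have e := etrans (esym (@derive_val _ _ _ _ _ _ _ H)) H0.
have e' := lorentzC (D1 l x) (F x).
move: e' e => ->; lra.
Qed.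

(** Differentiating <F, F_j> = 0 gives <F_i, F_j> + <F, F_ij> = 0. *)
Lemma lorentz_position_D2 x i j : U x -> lorentz (F x) (D2 i j x) = - g x i j.
Proof.
move=> Ux; have dF := differentiable_F x Ux.
have H := is_derive_lorentz F (D1 j) x (ebase i) dF (differentiable_D1 j x Ux).
have H0 : 'D_(ebase i) (fun y => lorentz (F y) (D1 j y)) x = 0.
  rewrite -(derive_cst (0 : R) x (ebase i)); apply: near_eq_derive.
  by apply: filterS (near_U _ Ux) => y; exact: lorentz_position_tangent.
have e := etrans (esym (@derive_val _ _ _ _ _ _ _ H)) H0.
rewrite metricE//; apply/eqP; rewrite -addr_eq0 addrC; apply/eqP.
exact: e.
Qed.

(** As F is normal, only the time axis itself contributes. The value is nonzero on the cone, which
    makes F and T a frame of the normal plane. *)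
Lemma lorentz_normal_position x : U x -> lorentz (T x) (F x) = - F x 0 0.
Proof.
move=> Ux; rewrite lorentz_normal_part_normal ?lorentz_ebase0// => l.
exact: lorentz_position_tangent.
Qed.

(** Since F is null, pairing with F determines the coefficient [b] of T; pairing with T then
    determines that of F. The difference of the two sides is orthogonal to a frame of the whole
    space, hence zero. *)
Lemma normal_decomposition x v : U x -> (forall l, lorentz v (D1 l x) = 0) ->
  let b := - lorentz v (F x) / F x 0 0 in
  v = (- (lorentz v (T x) - b * lorentz (T x) (T x)) / F x 0 0) *: F x + b *: T x.
Proof.
move=> Ux vn b; have [FF F0] := coneU x Ux.
have FT := lorentz_normal_position x Ux.
have Tn l : lorentz (T x) (D1 l x) = 0 by exact: lorentz_normal_part_tangent.
have Fn l := lorentz_position_tangent x l Ux.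
have Fx0 : F x 0 0 != 0 by rewrite gt_eqF.
have bE : b = - lorentz v (F x) / F x 0 0 by [].
move: (T x) Tn FT b bE => t Tn FT b bE.
set a := (_ / _).
apply/eqP; rewrite -subr_eq0; apply/eqP.
(* [e] is the tangent frame and [n] the normal frame. *)
pose e (i : 'I_2) := D1 i x.
pose n (i : 'I_2) := if i == 0 then F x else t.
apply: (lorentz_nondegenerate e n).
- by move=> i j; rewrite lorentzC /n; case: ifP => _; [exact: Fn|exact: Tn].
- rewrite (_ : (\matrix_(i, j) _) = g x).
    by rewrite gt_eqF// riemannian_det_gt0//; exact: gU.
  by apply/matrixP => i j; rewrite metricE// mxE.
(* The Gram determinant of F and T is minus the square of psi0. *)
- rewrite det_mx2 !mxE /n/= FF mul0r sub0r oppr_eq0 (lorentzC (F x)) FT.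
  by rewrite mulrNN mulf_neq0.
- move=> i; rewrite lorentzDl lorentzNl lorentzDl !lorentzZl /e.
  by rewrite vn Fn Tn !mulr0 addr0 subr0.
- move=> i; rewrite lorentzDl lorentzNl lorentzDl !lorentzZl /n.
  case: ifP => _.
    by rewrite FF FT /a bE; field.
  by rewrite (lorentzC (F x)) FT /a bE; field.
Qed.

Lemma trace_metric x : U x -> \sum_i \sum_j invmx (g x) i j * g x i j = 2.
Proof.
move=> Ux; transitivity (\sum_(i < 2) (1 : R)); last by rewrite sum_ord2.
apply: eq_bigr => i _.
have /matrixP/(_ i i) := mulVmx (metric_unit x Ux); rewrite !mxE eqxx => e.
apply: etrans e; apply: eq_bigr => j _.
by congr (_ * _); exact: riemannian_sym (gU x Ux).
Qed.

Lemma second_form_ebase i j x : U x ->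
  second_form F (fun=> ebase i) (fun=> ebase j) x = normal_part F x (D2 i j x).
Proof.
move=> Ux; congr normal_part; apply: near_eq_derive.
by apply: filterS (near_U _ Ux) => y; exact: diff_ebase.
Qed.

(** The products of II_ij with F and T are - g_ij and [tau]. By [lorentz_gradient_normal], [N] is 1
    + |grad psi0|^2. *)
Lemma normal_D2_decomposition i j x : U x ->
  let N := - lorentz (T x) (T x) in
  let psi0 := F x 0 0 in
  let tau := lorentz (T x) (D2 i j x) in
  normal_part F x (D2 i j x) =
  (- (tau + g x i j / psi0 * N) / psi0) *: F x + (g x i j / psi0) *: T x.
Proof.
move=> Ux N psi0 tau.
have [_ F0] := coneU x Ux; have Fx0 : psi0 != 0 by rewrite gt_eqF.
have Fn l := lorentz_position_tangent x l Ux.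
have Tn l := lorentz_normal_part_tangent x (ebase 0) l Ux.
have IIn l := lorentz_normal_part_tangent x (D2 i j x) l Ux.
have IIF : lorentz (normal_part F x (D2 i j x)) (F x) = - g x i j.
  rewrite (lorentz_normal_part_normal x _ _ Ux Fn) -(lorentz_position_D2 _ _ _ Ux).
  exact: lorentzC.
have IIT : lorentz (normal_part F x (D2 i j x)) (T x) = tau.
  rewrite (lorentz_normal_part_normal x _ _ Ux Tn); exact: lorentzC.
have e := normal_decomposition x _ Ux IIn; cbv zeta in e.
rewrite IIF IIT opprK in e; refine (etrans e _).
by rewrite /N mulrN.
Qed.

(** Half the trace of the preceding decomposition, where g has trace 2 and [tau] has trace minus the
    Laplacian of psi0. *)
Lemma lightcone_mean_curvature x : U x ->
  let psi0 := F x 0 0 in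
  let N := - lorentz (T x) (T x) in
  mean_curvature F x =
  (laplacian g height x / (2 * psi0) - N / psi0 ^+ 2) *: F x + psi0^-1 *: T x.
Proof.
move=> Ux psi0 N.
have [_ F0] := coneU x Ux; have Fx0 : psi0 != 0 by rewrite gt_eqF.
have tr := trace_metric x Ux.
pose tau i j := lorentz (T x) (D2 i j x).
have lap : laplacian g height x = - \sum_i \sum_j invmx (g x) i j * tau i j.
  exact: laplacian_height.
have IIE i j : second_form F (fun=> ebase i) (fun=> ebase j) x =
    (- (tau i j + g x i j / psi0 * N) / psi0) *: F x + (g x i j / psi0) *: T x.
  by rewrite (second_form_ebase _ _ _ Ux) (normal_D2_decomposition _ _ _ Ux).
rewrite /mean_curvature.
under eq_bigr do under eq_bigr do rewrite IIE.
rewrite lap; clear lap IIE; clearbody tau N.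
move: (T x) (F x) (g x) tr psi0 Fx0 => t f G tr p p0.
have -> : \sum_i \sum_j invmx G i j *: ((- (tau i j + G i j / p * N) / p) *: f
      + (G i j / p) *: t) =
    (\sum_i \sum_j invmx G i j * (- (tau i j + G i j / p * N) / p)) *: f
    + (\sum_i \sum_j invmx G i j * (G i j / p)) *: t.
  rewrite !scaler_suml -big_split/=; apply: eq_bigr => i _.
  rewrite !scaler_suml -big_split/=; apply: eq_bigr => j _.
  by rewrite scalerDr !scalerA.
have -> : \sum_i \sum_j invmx G i j * (G i j / p) = 2 / p.
  rewrite -tr mulr_suml; apply: eq_bigr => i _.
  by rewrite mulr_suml; apply: eq_bigr => j _; rewrite mulrA.
(* The 2 in front of [N] is the trace of the metric; it cancels against the factor 1/2 of the mean
   curvature. *)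
have -> : \sum_i \sum_j invmx G i j * (- (tau i j + G i j / p * N) / p) =
    - (\sum_i \sum_j invmx G i j * tau i j) / p - 2 * N / p ^+ 2.
  rewrite -tr; transitivity (\sum_i \sum_j
     (- (invmx G i j * tau i j) / p - invmx G i j * G i j * N / p ^+ 2)).
    by apply: eq_bigr => i _; apply: eq_bigr => j _; field.
  rewrite !mulNr !mulr_suml -!sumrN -big_split/=; apply: eq_bigr => i _.
  by rewrite !mulr_suml -!sumrN -big_split/=; apply: eq_bigr => j _; rewrite mulNr.
move: (\sum_i _) => S.
rewrite scalerDr !scalerA; congr (_ *: _ + _ *: _); by field.
Qed.

(** In the Gauss equation no products of two values of [tau] occur, because F is null; what is
    linear in [tau] assembles to the Laplacian through the explicit inverse of g. *)
Lemma lightcone_gauss_curvature x : U x ->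
  let psi0 := F x 0 0 in
  let N := - lorentz (T x) (T x) in
  gauss_curvature g x = N / psi0 ^+ 2 - laplacian g height x / psi0.
Proof.
move=> Ux psi0 N.
have [_ F0] := coneU x Ux; have Fx0 : psi0 != 0 by rewrite gt_eqF.
have dg : \det (g x) != 0 by rewrite gt_eqF// riemannian_det_gt0//; exact: gU.
have g10 := riemannian_sym _ _ 1 0 (gU x Ux).
have Iu i j := invmx2E (g x) i j (metric_unit x Ux).
pose tau i j := lorentz (T x) (D2 i j x).
have tau10 : tau 1 0 = tau 0 1.
  have E := congr1 (fun v => lorentz (T x) v) (D2C 1 0 x Ux); exact: E.
(* II_ij is expanded in F and T, whose products with F_kl are - g_kl and [tau k l]. *)
have pair i j k l : lorentz (normal_part F x (D2 i j x)) (D2 k l x) =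
    (- (tau i j + g x i j / psi0 * N) / psi0) * - g x k l + g x i j / psi0 * tau k l.
  rewrite (normal_D2_decomposition _ _ _ Ux).
  refine (etrans (lorentzDl _ _ _) _); congr (_ + _).
    refine (etrans (lorentzZl _ _ _) _); congr (_ * _).
    exact: lorentz_position_D2.
  exact: lorentzZl.
have lap : laplacian g height x = - \sum_i \sum_j invmx (g x) i j * tau i j.
  exact: laplacian_height.
have P := congr2 (fun a b => a - b) (pair 1 1 0 0) (pair 0 1 1 0).
refine (etrans (gauss_curvatureE x Ux) (etrans (congr1 (fun a => a / \det (g x)) P) _)).
rewrite lap; clear lap P pair; clearbody tau N.
(* With the inverse metric written out, the claim is a rational identity in the entries of g and
   [tau], with denominators psi0 and the determinant. *)
rewrite !sum_ord2 !Iu; clear Iu.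
have -> : lift 0 0 = 1 :> 'I_2 by apply/val_inj.
have -> : lift 1 0 = 0 :> 'I_2 by apply/val_inj.
rewrite det_mx2 in dg *.
rewrite g10 tau10 in dg *.
rewrite /= !addn0 !add0n /= expr0 expr1 sqrrN expr1n.
move: (tau 0 0) (tau 0 1) (tau 1 1) (g x 0 0) (g x 0 1) (g x 1 1) dg => a b c A B C dg.
clearbody psi0; field.
by apply/andP.
Qed.

End LocalSurface.

(** * From a local parametrization to the surface *)

Theorem corollary3p7 (R : realType) (M : smooth_surface R)
    (hM : connected [set: M]) (psi : M -> 'rV[R]_4)
    (hpsi : spacelike psi) (hcone : range psi `<=` future_lightcone)
    (c : chart R M) (hc : atlas c) (p : M) (hp : chart_dom c p) :
  let xi := psi p in
  let T := T_field psi c p in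
  let psi0 := height psi p in
  let lap := surf_laplacian psi c (height psi) p in
  let gradn := surf_norm psi c p (surf_grad psi c (height psi) p) in
  let H := surf_mean psi c p in
  let K := surf_gauss psi c p in
  [/\ H = (lap / (2 * psi0) - (1 + gradn ^+ 2) / psi0 ^+ 2) *: xi
          + psi0^-1 *: T,
      K = (1 + gradn ^+ 2) / psi0 ^+ 2 - lap / psi0
    & K = lorentz H H].
Proof.
move=> xi T psi0 lap gradn H K.
case: hpsi => [[smooth _] riem].
pose x := Defs.coord c p.
have Uo : open (chart_img c) by exact: chart_img_open.
have Ux : chart_img c x by exists p.
have Fs := smooth c hc.
have gU y : chart_img c y -> riemannian_at (induced_metric (psi \o param c)) y.
  by move=> [q hq <-]; exact: riem.
have coneU y : chart_img c y -> future_lightcone ((psi \o param c) y).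
  by move=> _; apply: hcone; exists (param c y).
have Fx : (psi \o param c) x = xi by rewrite /= coordK.
have HE := lightcone_mean_curvature Uo Fs gU coneU x Ux.
have KE := lightcone_gauss_curvature Uo Fs gU coneU x Ux.
have TE := gradient_height_normal Fs x Ux.
have NE := lorentz_gradient_normal Fs gU x Ux.
have FT := lorentz_normal_position Uo Fs coneU x Ux.
have gradnE := metric_norm_sqr (induced_metric (psi \o param c)) x
  (surf_grad psi c (height psi) p) (gU x Ux).
have [FF F0] := coneU x Ux.
cbv zeta in HE, KE.
(* Replaces the normal part of the time axis by the field T of the statement. *)
rewrite -TE in NE FT HE KE.
rewrite NE opprK Fx in HE.
rewrite NE opprK Fx in KE.
rewrite Fx in FF F0 FT.
have p0 : psi0 != 0 by rewrite gt_eqF.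
have N2 : 1 + gradn ^+ 2 = - lorentz T T by rewrite [gradn ^+ 2]gradnE NE opprK.
have HH : H = (lap / (2 * psi0) - (1 + gradn ^+ 2) / psi0 ^+ 2) *: xi + psi0^-1 *: T.
  by rewrite [gradn ^+ 2]gradnE; exact: HE.
have KK : K = (1 + gradn ^+ 2) / psi0 ^+ 2 - lap / psi0.
  by rewrite [gradn ^+ 2]gradnE; exact: KE.
split=> //; rewrite KK HH.
have FT' : lorentz T xi = - psi0 by exact: FT.
(* Write H as a xi + T / psi0. As xi is null and <T, xi> = - psi0, the square of H is - 2 a + <T, T>
   / psi0^2, which is K. *)
rewrite lorentzDl !lorentzDr !lorentzZl !lorentzZr FF (lorentzC xi) FT' N2.
clearbody psi0 lap T; field.
by [].
Qed.
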